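(* Let $n\ge1$ and let $w_1,\dots,w_n,u_1,\dots,u_n\in V$ be words. The adjoint of the operator $\mathbf{\Psi}^{w_1,\dots,w_n}_{u_1,\dots,u_n}$ is $$\big(\mathbf{\Psi}^{w_1,\dots,w_n}_{u_1,\dots,u_n}\big)^*=\mathbf{\Psi}^{u_1,\dots,u_n}_{w_1,\dots,w_n};$$ that is, for all $\ell\in T(\mathbb{R}^d)$ and $x\in T((\mathbb{R}^d))$, $$\big\langle\ell,\mathbf{\Psi}^{w_1,\dots,w_n}_{u_1,\dots,u_n}(x)\big\rangle=\big\langle\mathbf{\Psi}^{u_1,\dots,u_n}_{w_1,\dots,w_n}(\ell),x\big\rangle .$$
   Context: $V$ is the set of finite words (including the empty word) in the alphabet $\{1,\dots,d\}$; $T((\mathbb{R}^d))=\prod_{n\ge0}(\mathbb{R}^d)^{\otimes n}$ with the product topology, elements written $x=\sum_{v\in V}x^vv$ (words identified with basis tensors); $T(\mathbb{R}^d)$ is the subspace of elements with finitely many nonzero coordinates; pairing $\langle\ell,x\rangle=\sum_v\ell^vx^v$. For a continuous linear operator $\mathbf{A}:T((\mathbb{R}^d))\to T((\mathbb{R}^d))$, its adjoint $\mathbf{A}^*:T(\mathbb{R}^d)\to T(\mathbb{R}^d)$ is defined by $\langle\ell,\mathbf{A}x\rangle=\langle\mathbf{A}^*\ell,x\rangle$ for all $\ell\in T(\mathbb{R}^d)$, $x\in T((\mathbb{R}^d))$. The switching operator is $$\mathbf{\Psi}^{w_1,\dots,w_n}_{u_1,\dots,u_n}(x)=\sum_{v_0,\dots,v_n\in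 V}x^{v_0w_1v_1\cdots w_nv_n}\,(v_0u_1v_1\cdots u_nv_n).$$ *)

(* Defs.v *)
From HB Require Import structures.
From mathcomp Require Import all_boot all_order all_algebra finmap.
From mathcomp Require Import all_classical all_reals all_analysis summability.

Set Implicit Arguments.
Unset Strict Implicit.
Unset Printing Implicit Defensive.

Import Order.TTheory GRing.Theory Num.Theory.
Import numFieldTopology.Exports.

Local Open Scope classical_set_scope.
Local Open Scope ring_scope.

Definition word (d : nat) := seq 'I_d.

HB.instance Definition _ (d : nat) := Countable.on (word d).

(* T((R^d)): an element is its family of coordinates x^v, v a word; the
   coordinates indexed by the words of length n make up its component in
   (R^d)^{\otimes n}. The topology is the product topology. *)
Definition tensor_series (R : realType) (d : nat) := {ptws word d -> R}.

HB.instance Definition _ (R : realType) (d : nat) :=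
  Topological.on (tensor_series R d).
HB.instance Definition _ (R : realType) (d : nat) :=
  GRing.Lmodule.copy (tensor_series R d) (word d -> R^o).

(* T(R^d), used below as a type through the coercion from sets to types *)
Definition tensor_poly (R : realType) (d : nat) : set (tensor_series R d) :=
  [set l | finite_set [set v | l v != 0]].
Arguments tensor_poly R d : clear implicits.

Definition pairing (R : realType) (d : nat)
    (l : tensor_poly R d) (x : tensor_series R d) : R :=
  \sum_(v \in [set: word d]) val l v * x v.

Record cont_operator (R : realType) (d : nat) := ContOperator {
  cont_operator_fun :> {linear tensor_series R d -> tensor_series R d} ;
  cont_operator_continuous : continuous cont_operator_fun }.

Definition is_adjoint (R : realType) (d : nat)
    (A : cont_operator R d) (B : tensor_poly R d -> tensor_poly R d) :=
  forall (l : tensor_poly R d) (x : tensor_series R d),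
    pairing l (A x) = pairing (B l) x.

(* v_0 w_1 v_1 ... w_n v_n *)
Definition interleave (d n : nat)
    (w : n.-tuple (word d)) (v : n.+1.-tuple (word d)) : word d :=
  tnth v ord0 ++ \big[cat/[::]]_(i < n) (tnth w i ++ tnth v (lift ord0 i)).

Definition word_tensor (R : realType) (d : nat) (z : word d) :
  tensor_series R d := fun z' => (z == z')%:R.
Arguments word_tensor R {d} z.

(* The series over v_0, ..., v_n is taken coordinate by coordinate: each
   coordinate is a finite sum (finite_interleave). It is also the
   unconditional sum of the series for the topology of T((R^d))
   (switching_fun_cvg). *)
Definition switching_fun (R : realType) (d n : nat)
    (w u : n.-tuple (word d)) (x : tensor_series R d) : tensor_series R d :=
  fun z => \sum_(v \in [set: n.+1.-tuple (word d)])
    x (interleave w v) * word_tensor R (interleave u v) z.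

Section interleave_theory.
Context (d n : nat).
Implicit Types (w u : n.-tuple (word d)) (v : n.+1.-tuple (word d)).

Lemma size_tnth_interleave w v i : (size (tnth v i) <= size (interleave w v))%N.
Proof.
rewrite /interleave size_cat.
case: (unliftP ord0 i) => [j ->|->]; last by rewrite leq_addr.
apply: leq_trans (leq_addl _ _).
rewrite (big_morph size (@size_cat _) (erefl _)) (bigD1 j)//= size_cat.
by rewrite -addnA addnCA leq_addr.
Qed.

Lemma finite_interleave w (z : word d) : finite_set [set v | interleave w v = z].
Proof.
pose f (t : n.+1.-tuple {bseq (size z) of 'I_d}) : n.+1.-tuple (word d) :=
  map_tuple (fun b : {bseq (size z) of 'I_d} => (b : seq 'I_d)) t.
apply: (@sub_finite_set _ _ (range f)); last exact/finite_image/finite_finset.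
move=> v /= vz.
have sz i : (size (tnth v i) <= size z)%N by rewrite -vz size_tnth_interleave.
exists [tuple Bseq (sz i) | i < n.+1] => //.
by apply: eq_from_tnth => i; rewrite /f tnth_map tnth_mktuple.
Qed.

Lemma finite_interleave_preimage w (D : set (word d)) : finite_set D ->
  finite_set [set v | D (interleave w v)].
Proof.
move=> fD; apply: (@sub_finite_set _ _ (\bigcup_(z in D) [set v | interleave w v = z])).
  by move=> v /= Dv; exists (interleave w v).
by apply: bigcup_finite => // z _; exact: finite_interleave.
Qed.

End interleave_theory.

Lemma tensor_series_cvg (R : realType) (d : nat) (T : Type) (F : set_system T)
    (FF : Filter F) (g : T -> tensor_series R d) (x : tensor_series R d) :
  (forall z, (g t z) @[t --> F] --> x z) -> g @ F --> x.
Proof.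
move=> gx; apply/cvg_sup => z U [V] [[W oW <-] Wx] WU.
have Wn : nbhs (x z) W by apply: open_nbhs_nbhs; split.
have := gx z _ Wn; rewrite /= !nbhs_filterE /fmap/=.
by apply: (@filterS _ F) => t /= Wt; exact: WU.
Qed.

Lemma tensor_series_coord_cvg (R : realType) (d : nat) (z : word d)
  (x : tensor_series R d) : (y z : R) @[y --> x] --> x z.
Proof. exact: (@proj_continuous _ (fun=> R) z x). Qed.

Section switching_theory.
Context (R : realType) (d n : nat) (w u : n.-tuple (word d)).
Implicit Types (x : tensor_series R d) (z : word d).

Lemma switching_funE x z : switching_fun w u x z =
  \sum_(v <- fset_set [set v | interleave u v = z]) x (interleave w v).
Proof.
rewrite -fsbig_finite/=; last exact: finite_interleave.
rewrite /switching_fun [RHS]fsbig_mkcond/=.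
apply: eq_fsbigr => v _; rewrite patchE /word_tensor.
case: ifPn => [/set_mem/= ->|]; first by rewrite eqxx mulr1.
by case: eqP => [<-|]; [rewrite notin_setE/= => /(_ erefl)|rewrite mulr0].
Qed.

Lemma switching_fun_cvg x :
  (\sum_(v <- F) x (interleave w v) *: word_tensor R (interleave u v))
     @[F --> totally] --> switching_fun w u x.
Proof.
have totF := @totally_filter (n.+1.-tuple (word d)).
apply: tensor_series_cvg => z; apply: cvg_near_cst.
exists (fset_set [set v | interleave u v = z]) => //= F /fsubsetP sF.
have -> : (\sum_(v <- F) x (interleave w v) *: word_tensor R (interleave u v)) z
    = \sum_(v <- F) x (interleave w v) * word_tensor R (interleave u v) z.
  by elim/big_rec2: _ => // v a b _ <-.
rewrite /switching_fun fsbig_seq ?fset_uniq//=.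
apply: fsbig_widen => // v [_ /= vF]; rewrite /word_tensor.
case: eqP => [uv|_]; last by rewrite mulr0.
case: vF; apply: sF; rewrite in_fset_set; last exact: finite_interleave.
exact/mem_set.
Qed.

Lemma switching_fun_linear : linear (switching_fun w u : _ -> tensor_series R d).
Proof.
move=> a x y; apply/funext => z.
rewrite switching_funE.
have -> : (a *: switching_fun w u x + switching_fun w u y) z =
  a * switching_fun w u x z + switching_fun w u y z by [].
by rewrite !switching_funE mulr_sumr -big_split.
Qed.

HB.instance Definition _ := GRing.isLinear.Build R (tensor_series R d)
  (tensor_series R d) *:%R (switching_fun w u) switching_fun_linear.

Lemma switching_fun_continuous :
  continuous (switching_fun w u : tensor_series R d -> tensor_series R d).
Proof.
move=> x; apply: (@tensor_series_cvg _ _ _ _ (nbhs_filter x)) => z.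
have -> : (fun y => switching_fun w u y z) = fun y : tensor_series R d =>
    \sum_(v <- fset_set [set v | interleave u v = z]) y (interleave w v).
  by apply/funext => y; exact: switching_funE.
rewrite switching_funE.
elim: (enum_fset _) => [|v s IH].
  rewrite big_nil; under eq_fun do rewrite big_nil.
  exact: cvg_cst.
rewrite big_cons; under eq_fun do rewrite big_cons.
apply: (@cvgD R R^o) => //; exact: tensor_series_coord_cvg.
Qed.

Definition switching : cont_operator R d :=
  @ContOperator R d (switching_fun w u) switching_fun_continuous.

Lemma switching_fun_poly (l : tensor_poly R d) :
  switching_fun w u (val l) \in tensor_poly R d.
Proof.
apply/mem_set; have /set_mem fl := valP l.
apply: (@sub_finite_set _ _ (interleave u @`
    [set v | val l (interleave w v) != 0])); last first.
  apply: finite_image.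
  exact: (@finite_interleave_preimage _ _ w [set z | val l z != 0]).
move=> z /=; rewrite switching_funE => /eqP nz.
have [//|nex] := pselect ((interleave u @` [set v | val l (interleave w v) != 0]) z).
case: nz; rewrite big_seq big1// => v.
rewrite in_fset_set; last exact: finite_interleave.
move=> /set_mem /= vz; apply/eqP/negPn/negP => lv0.
by apply: nex; exists v.
Qed.

(* restriction of the switching operator to T(R^d) *)
Definition switching_poly (l : tensor_poly R d) : tensor_poly R d :=
  exist _ (switching_fun w u (val l)) (switching_fun_poly l).

End switching_theory.

Section adjoint_theory.
Context (R : realType) (d : nat).
Implicit Types (l : tensor_poly R d) (x : tensor_series R d) (z v : word d).

Lemma pairing_seq l x (s : seq (word d)) : uniq s ->
  (forall z, val l z != 0 -> z \in s) ->
  pairing l x = \sum_(z <- s) val l z * x z.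
Proof.
move=> us ls.
have -> : \sum_(z <- s) val l z * x z = \sum_(z \in [set` s]) val l z * x z.
  by rewrite -fsbig_seq.
apply: esym; apply: fsbig_widen => // z [_ /= zs].
by have [->|/ls] := eqVneq (val l z) 0; first by rewrite mul0r.
Qed.

Lemma word_tensor_poly v : word_tensor R v \in tensor_poly R d.
Proof.
apply/mem_set; apply: (@sub_finite_set _ _ [set v]) => // z /=.
by rewrite /word_tensor /=; case: (v =P z) => [->//|_]; rewrite eqxx.
Qed.

Lemma pairing_word_tensor l v : pairing l (word_tensor R v) = val l v.
Proof.
have /set_mem fl := valP l.
have fv : finite_set (v |` [set z | val l z != 0]) by rewrite finite_setU.
rewrite (@pairing_seq _ _ (fset_set (v |` [set z | val l z != 0]))) ?fset_uniq//.
  rewrite (bigD1_seq v) ?fset_uniq//=; last first.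
    by rewrite in_fset_set// mem_set//; left.
  rewrite /word_tensor eqxx mulr1 big1 ?addr0// => z zv.
  by rewrite eq_sym (negbTE zv) mulr0.
by move=> z lz; rewrite in_fset_set// mem_set//; right.
Qed.

Lemma tensor_series_split x (s : seq (word d)) : uniq s ->
  exists2 y : tensor_series R d, (forall v, v \in s -> y v = 0) &
    x = \sum_(v <- s) x v *: word_tensor R v + y.
Proof.
move=> us; set p := \sum_(v <- s) _.
exists (x - p); last by rewrite addrC subrK.
have pE z : p z = \sum_(v <- s) x v * (v == z)%:R.
  by rewrite /p; elim/big_rec2: _ => // v a b _ <-.
move=> v vs; have -> : (x - p) v = x v - p v by [].
rewrite pE (bigD1_seq v)//= eqxx mulr1 big1 ?addr0 ?subrr// => z zv.
by rewrite (negbTE zv) mulr0.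
Qed.

(* a continuous linear form depends on finitely many coordinates *)
Lemma cont_operator_finite (A : cont_operator R d) z :
  exists s : seq (word d), forall x, (forall v, v \in s -> x v = 0) -> A x z = 0.
Proof.
pose K (s : seq (word d)) : set (tensor_series R d) :=
  [set x | forall v, v \in s -> x v = 0].
pose F := filter_from [set: seq (word d)] K.
have FF : Filter F.
  apply: filter_fromT_filter; first by exists [::].
  move=> s t; exists (s ++ t) => x Kx; split=> v vs; apply: Kx;
  by rewrite mem_cat vs ?orbT.
have F0 : F --> (0 : tensor_series R d).
  apply: (@tensor_series_cvg _ _ _ _ FF id) => v; apply: cvg_near_cst.
  by exists [:: v] => // x Kx; apply: Kx; rewrite inE.
have A0 : (A x z) @[x --> F] --> (0 : R).
  have -> : (0 : R) = A 0 z by rewrite linear0.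
  have AF : A @ F --> A 0.
    exact: (cvg_comp id A F0 (@cont_operator_continuous _ _ A 0)).
  exact: (cvg_comp A _ AF (@tensor_series_coord_cvg R d z (A 0))).
have [s _ sA] : F [set x | `|A x z| < 1].
  have /A0 : nbhs (0 : R) (ball (0 : R) 1) by exact: nbhsx_ballx.
  by apply: (@filterS _ F) => x /=; rewrite /ball /= sub0r normrN.
exists s => x Kx; apply/eqP/negPn/negP => Axz.
have lt1 : `|A ((A x z)^-1 *: x) z| < 1.
  apply: sA => v vs.
  have -> : ((A x z)^-1 *: x) v = (A x z)^-1 * x v by [].
  by rewrite Kx// mulr0.
have Az : A ((A x z)^-1 *: x) z = (A x z)^-1 * A x z by rewrite linearZ.
by move: lt1; rewrite Az mulVf// normr1 ltxx.
Qed.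

Lemma adjoint_exists (A : cont_operator R d) : exists B, is_adjoint A B.
Proof.
suff adj l : exists m : tensor_poly R d, forall x, pairing l (A x) = pairing m x.
  by have [B BA] := choice adj; exists B.
have /set_mem fl := valP l.
have [f fP] := choice (cont_operator_finite A).
pose s := undup (flatten [seq f z | z <- fset_set [set z | val l z != 0]]).
have us : uniq s by exact: undup_uniq.
have sP z x : val l z != 0 -> (forall v, v \in s -> x v = 0) -> A x z = 0.
  move=> lz xs; apply: fP => v vf; apply: xs; rewrite mem_undup.
  apply/flatten_mapP; exists z => //.
  by rewrite in_fset_set// mem_set.
pose m : tensor_series R d := fun v => pairing l (A (word_tensor R v)).
have m0 v : v \notin s -> m v = 0.
  move=> vs; rewrite /m /pairing fsbig1// => z _.
  have [->|lz] := eqVneq (val l z) 0; first by rewrite mul0r.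
  rewrite (sP _ _ lz) ?mulr0// => t ts; rewrite /word_tensor.
  by case: eqP vs => // ->; rewrite ts.
have mp : m \in tensor_poly R d.
  apply/mem_set; apply: (@sub_finite_set _ _ [set` s]); last exact: finite_seq.
  by move=> v /= mv; apply/negPn/negP => /m0; apply/eqP.
exists (exist _ m mp) => x.
rewrite [RHS](@pairing_seq _ _ s)//=; last first.
  by move=> v; apply: contraNT => /m0 ->.
have [y ys xE] := tensor_series_split x us.
have AE z : val l z != 0 ->
    A x z = \sum_(v <- s) x v * A (word_tensor R v) z.
  move=> lz; rewrite {1}xE linearD linear_sum.
  have -> (a b : tensor_series R d) : (a + b) z = a z + b z by [].
  rewrite (sP _ _ lz ys) addr0.
  elim/big_rec2: _ => // v a b _ <-; rewrite linearZ; by [].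
have lE := fun x => @pairing_seq l x _ (fset_uniq (fset_set [set z | val l z != 0])).
have lin z : val l z != 0 -> z \in fset_set [set z | val l z != 0].
  by move=> lz; rewrite in_fset_set// mem_set.
rewrite lE//; under [RHS]eq_bigr do rewrite /m lE// mulr_suml.
rewrite exchange_big/= big_seq [RHS]big_seq; apply: eq_bigr => z.
rewrite in_fset_set// => /set_mem/= lz.
by rewrite AE// mulr_sumr; apply: eq_bigr => v _; rewrite mulrA mulrAC.
Qed.

Definition adjoint (A : cont_operator R d) : tensor_poly R d -> tensor_poly R d :=
  sval (cid (adjoint_exists A)).

Lemma adjointP (A : cont_operator R d) : is_adjoint A (adjoint A).
Proof. exact: svalP (cid (adjoint_exists A)). Qed.

Lemma adjoint_unique (A : cont_operator R d) B : is_adjoint A B -> B = adjoint A.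
Proof.
move=> AB; apply/funext => l; apply/val_inj/funext => v.
by rewrite -!pairing_word_tensor -AB adjointP.
Qed.

End adjoint_theory.

(* Main.v *)
(** Both pairings equal the sum of [l^{v_0 u_1 v_1 ... u_n v_n}
    x^{v_0 w_1 v_1 ... w_n v_n}] over the tuples [v], in which only finitely
    many terms are nonzero: a given word has finitely many factorizations
    [v_0 u_1 v_1 ... u_n v_n], and [l] has finite support. *)

Require Import Defs.
From mathcomp Require Import all_boot all_order all_algebra.
From mathcomp Require Import finmap.
From mathcomp Require Import all_classical all_reals all_analysis.

Section switching_adjoint.
Import GRing.Theory.
Local Open Scope classical_set_scope.
Local Open Scope ring_scope.
Context (R : realType) (d n : nat).
Implicit Types (w u : n.-tuple (word d)) (l : tensor_poly R d).
Implicit Types (x : tensor_series R d) (z : word d).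

Lemma sum_word_tensor z x (s : seq (word d)) : uniq s -> z \in s ->
  \sum_(t <- s) word_tensor R z t * x t = x z.
Proof.
move=> us zs; rewrite (bigD1_seq z)//= /word_tensor eqxx mul1r big1 ?addr0// => t.
by rewrite eq_sym => /negbTE ->; rewrite mul0r.
Qed.

(** The list [s] may be larger than the set of contributing tuples, so one [s] can serve many
    coordinates [z] at once; this is what lets the sums over words and over tuples be exchanged. *)
Lemma switching_fun_seq w u x z (s : seq (n.+1.-tuple (word d))) : uniq s ->
  (forall v, interleave u v = z -> x (interleave w v) != 0 -> v \in s) ->
  switching_fun w u x z =
  \sum_(v <- s) x (interleave w v) * word_tensor R (interleave u v) z.
Proof.
move=> us sP; rewrite [RHS]fsbig_seq//.
apply: esym; apply: fsbig_widen => // v [_ /= vs]; rewrite /word_tensor.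
case: eqP => [uv|_]; last by rewrite mulr0.
by have [->|/(sP _ uv)//] := eqVneq (x (interleave w v)) 0; rewrite mul0r.
Qed.

Lemma pairing_switching w u l x :
  pairing l (switching R w u x) = pairing (switching_poly u w l) x.
Proof.
have /set_mem fl := valP l.
set supp := [set z | val l z != 0] in fl.
have fS := @finite_interleave_preimage _ _ u _ fl.
(* [S] indexes the common value of both pairings: exactly the tuples whose coefficient from [l] is
   nonzero. *)
pose S := fset_set [set v | supp (interleave u v)].
have SP v : (v \in S) = (val l (interleave u v) != 0).
  by rewrite in_fset_set//; apply/idP/idP => [/set_mem|/mem_set].
have suppP z : (z \in fset_set supp) = (val l z != 0).
  by rewrite in_fset_set//; apply/idP/idP => [/set_mem|/mem_set].
transitivity (\sum_(v <- S) val l (interleave u v) * x (interleave w v)).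
  rewrite (@pairing_seq _ _ _ _ (fset_set supp)) ?fset_uniq//; last first.
    by move=> z; rewrite suppP.
  (* For [z] in the support of [l], every [v] with [interleave u v = z] lies in [S], whatever [x]
     is. *)
  transitivity (\sum_(z <- fset_set supp) \sum_(v <- S)
      x (interleave w v) * (word_tensor R (interleave u v) z * val l z)).
    rewrite big_seq [RHS]big_seq; apply: eq_bigr => z; rewrite suppP => lz.
    rewrite [switching R w u x z](@switching_fun_seq _ _ _ _ S) ?fset_uniq//.
      by rewrite mulrC mulr_suml; apply: eq_bigr => v _; rewrite mulrA.
    by move=> v uv _; rewrite SP uv.
  rewrite exchange_big/= big_seq [RHS]big_seq; apply: eq_bigr => v vS.
  by rewrite -mulr_sumr sum_word_tensor ?fset_uniq 1?mulrC// suppP -SP.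
(* These words contain the support of the image of [l]; distinct tuples may yield the same word,
   hence [undup]. *)
pose s := undup [seq interleave w v | v <- S].
(* Here [S] suffices for every [z], since tuples outside it have coefficient zero in [l]. *)
have lE z : val (switching_poly u w l) z =
    \sum_(v <- S) val l (interleave u v) * word_tensor R (interleave w v) z.
  by apply: switching_fun_seq; rewrite ?fset_uniq// => v _; rewrite SP.
rewrite [RHS](@pairing_seq _ _ _ _ s) ?undup_uniq//; last first.
  move=> z; rewrite lE; apply: contraNT => zs; rewrite big_seq big1// => v vS.
  rewrite /word_tensor; case: eqP => [wv|_]; last by rewrite mulr0.
  by case/negP: zs; rewrite mem_undup -wv map_f.
under [RHS]eq_bigr do rewrite lE mulr_suml.
rewrite exchange_big/= big_seq [RHS]big_seq; apply: eq_bigr => v vS.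
under eq_bigr do rewrite -mulrA.
by rewrite -mulr_sumr sum_word_tensor ?undup_uniq// mem_undup map_f.
Qed.

End switching_adjoint.

Theorem proposition5p4 (R : realType) (d n : nat) (n_ge1 : (1 <= n)%N)
    (w u : n.-tuple (word d)) :
  adjoint (switching R w u) = @switching_poly R d n u w /\
  (forall (l : tensor_poly R d) (x : tensor_series R d),
     pairing l (switching R w u x) = pairing (switching_poly u w l) x).
Proof.
split; last exact: pairing_switching.
(* Pairing with word tensors reads off coordinates, so the duality identity determines the
   adjoint. *)
by apply/esym/adjoint_unique => l x; exact: pairing_switching.
Qed.
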